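(* Let $X=\mathbb{Z}[\frac12]\cap(0,1)$ with the action of Thompson's group $F$ and root $p=\frac58$. Let $k\ge1$ and for $i=1,\dots,k$ let $f_i:\mathcal{P}_f(X)\to\mathbb{R}$ be the min-function of a positive superharmonic function $\varphi_i:X\to\mathbb{R}$ satisfying $\varphi_i(q)\le\varphi_i(p)$ for all $q\in X$. Let $P$ be the Markov operator on functions on $\mathcal{P}_f(X)$ given by $Pf(E)=\frac15\big(f(aE)+f(bE)+f(a^{-1}E)+f(b^{-1}E)+f(E\,\Delta\,\{p\})\big)$. Then for any integers $n_1,\dots,n_k\ge0$, the function $h=P^{n_1}f_1+\dots+P^{n_k}f_k$ has an approximation in the strong sense: there is a sequence $E_n\in\mathcal{P}_f(X)$ such that for any $g\in\mathcal{P}_f(X)\rtimes F$, $\frac{h(gE_n)}{h(E_n)}\to1$ as $n\to\infty$.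
   Context: Thompson's group $F$ is the group of orientation-preserving piecewise linear homeomorphisms of $[0,1]$ with finitely many breakpoints, all dyadic rationals, and all slopes integer powers of $2$; it acts on $X=\mathbb{Z}[\frac12]\cap(0,1)$. It is generated by $a$ and $b$, where $a(x)=2x$ on $[0,\frac14]$, $a(x)=\frac x2+\frac38$ on $[\frac14,\frac34]$, $a(x)=x$ on $[\frac34,1]$; and $b(x)=x$ on $[0,\frac12]$, $b(x)=\frac x2+\frac14$ on $[\frac12,\frac34]$, $b(x)=x-\frac18$ on $[\frac34,\frac78]$, $b(x)=2x-1$ on $[\frac78,1]$. Root: $p=\frac58$. A function $\varphi:X\to\mathbb{R}$ is superharmonic if $\varphi(x)\ge\frac14(\varphi(ax)+\varphi(bx)+\varphi(a^{-1}x)+\varphi(b^{-1}x))$ for all $x\in X$. $\mathcal{P}_f(X)$ is the set of finite subsets of $X$. The lamplighter group $\mathcal{P}_f(X)\rtimes F$ has multiplication $(E,g)(E',h)=(E\,\Delta\,gE',gh)$ and acts on $\mathcal{P}_f(X)$ by $(E,g)(E')=E\,\Delta\,gE'$. The min-function of $\varphi$ is $f:\mathcal{P}_f(X)\to\mathbb{R}$, $f(E)=\min_{x\in E}\varphi(x)$ for $E\ne\varnothing$, $f(\varnothing)=\varphi(p)$. *)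

(* Defs.v *)
From HB Require Import structures.
From mathcomp Require Import all_boot all_order all_algebra finmap.
From mathcomp Require Import all_classical all_reals all_analysis.
From mathcomp Require Import ring lra.

Set Implicit Arguments.
Unset Strict Implicit.
Unset Printing Implicit Defensive.

Import Order.TTheory GRing.Theory Num.Theory.
Import numFieldNormedType.Exports.

Local Open Scope ring_scope.

(* The ring Z[1/2], as a subset of R. *)
Definition dyadic (R : realType) (x : R) : Prop :=
  exists (m : int) (k : nat), x = m%:~R / 2 ^+ k.

(* The points of B are the admissible breakpoints: g is affine, with slope an
   integer power of 2, on every subinterval [u, v] of [0, 1] whose interior
   contains no point of B. *)
Definition dyadic_pl (R : realType) (g : R -> R) : Prop :=
  exists2 B : seq R, (forall w, w \in B -> dyadic w) &
    forall u v : R, 0 <= u -> u < v -> v <= 1 ->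
      (forall w, w \in B -> ~~ (u < w < v)) ->
      exists m : int, forall x, u <= x <= v -> g x = g u + 2 ^ m * (x - u).

(* An orientation-preserving homeomorphism of [0, 1] fixes 0 and 1; it is
   represented by its extension to R by the identity, so that two elements are
   equal iff they agree on [0, 1]. *)
Record thompson (R : realType) := Thompson {
  tmap : R -> R;
  tmapV : R -> R;
  tmapK : cancel tmap tmapV;
  tmapVK : cancel tmapV tmap;
  tmap_continuous : continuous tmap;
  tmapV_continuous : continuous tmapV;
  tmap_lt : {homo tmap : x y / x < y};
  tmap_out : forall x, ~~ (0 < x < 1) -> tmap x = x;
  tmap_pl : dyadic_pl tmap }.

Lemma thompson_eq (R : realType) (g h : thompson R) :
  tmap g =1 tmap h -> g = h.
Proof.
move=> /funext; case: g => g g' gK g'K gc g'c glt gout gpl.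
case: h => h h' hK h'K hc h'c hlt hout hpl /= eqgh; subst h.
have eqV : g' = h' by apply/funext => x; rewrite -{1}(h'K x) gK.
by subst h'; f_equal; apply: Prop_irrelevance.
Qed.

Section Dyadic.
Variable R : realType.
Implicit Types x y : R.

Lemma dyadic0 : dyadic (0 : R).
Proof. by exists 0, 0%N; rewrite mul0r. Qed.

Lemma dyadic1 : dyadic (1 : R).
Proof. by exists 1, 0%N; rewrite expr0 divr1. Qed.

Lemma dyadicD x y : dyadic x -> dyadic y -> dyadic (x + y).
Proof.
move=> [m [k ->]] [n [l ->]].
exists (m * 2 ^+ l + n * 2 ^+ k), (k + l)%N.
rewrite rmorphD !rmorphM !rmorphXn /= exprD.
have h2 j : (2 : R) ^+ j != 0 by rewrite expf_neq0 ?pnatr_eq0.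
by field; rewrite !h2.
Qed.

Lemma dyadicN x : dyadic x -> dyadic (- x).
Proof. by move=> [m [k ->]]; exists (- m), k; rewrite rmorphN mulNr. Qed.

Lemma dyadicM x y : dyadic x -> dyadic y -> dyadic (x * y).
Proof.
move=> [m [k ->]] [n [l ->]]; exists (m * n), (k + l)%N.
have h2 j : (2 : R) ^+ j != 0 by rewrite expf_neq0 ?pnatr_eq0.
by rewrite rmorphM /= exprD; field; rewrite !h2.
Qed.

Lemma dyadicX (m : int) : dyadic ((2 : R) ^ m).
Proof.
case: m => n.
  by exists (2 ^+ n), 0%N; rewrite expr0 divr1 rmorphXn.
by exists 1, n.+1; rewrite mul1r.
Qed.

End Dyadic.

Section ThompsonGroup.
Variable R : realType.
Implicit Types g h : thompson R.

Lemma tmap_mono g : {mono tmap g : x y / x < y}.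
Proof. by apply: leW_mono; apply: le_mono; exact: tmap_lt. Qed.

Lemma tmap0 g : tmap g 0 = 0.
Proof. by rewrite tmap_out // ltxx. Qed.

Lemma tmap1 g : tmap g 1 = 1.
Proof. by rewrite tmap_out // ltxx andbF. Qed.

Lemma count_lt (B : seq R) (u x : R) : u \in B -> u < x ->
  (count (fun w => (w < u)%R) B < count (fun w => (w < x)%R) B)%N.
Proof.
move=> uB ux; have sub w : (w < u)%R -> (w < x)%R by move/lt_trans; apply.
elim: B uB => // b B IHB; rewrite in_cons => /orP[/eqP <-|uB] /=.
  by rewrite ltxx ux add0n add1n ltnS; apply: sub_count.
rewrite -addnS leq_add ?IHB //.
by case bu: (b < u)%R => //; rewrite (sub _ bu).
Qed.

Lemma tmap_dyadic g (x : R) : 0 <= x <= 1 -> dyadic x -> dyadic (tmap g x).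
Proof.
case: (tmap_pl g) => B Bd Bpl.
have [n] := ubnP (count (fun w => w < x) B).
elim: n x => // n IHn x; rewrite ltnS => cx /andP[x0 x1] dx.
move: x0; rewrite le_eqVlt => /orP[/eqP <-|x0].
  by rewrite tmap0; exact: dyadic0.
pose C := [seq w <- B | 0 < w < x].
pose u := \big[Num.max/0]_(w <- C) w.
have u0 : 0 <= u.
  by rewrite /u; elim/big_rec: _ => // w z _ z0; rewrite le_max z0 orbT.
have uC : u = 0 \/ u \in C.
  rewrite /u; elim: C {u u0} => [|c C IHC]; first by left; rewrite big_nil.
  rewrite big_cons in_cons; case: leP => _; last by right; rewrite eqxx.
  by case: IHC => [|->]; [left|right; rewrite orbT].
have ux : u < x by case: uC => [-> //|]; rewrite mem_filter => /andP[/andP[]].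
have du : dyadic (tmap g u).
  case: uC => [->|]; first by rewrite tmap0; exact: dyadic0.
  rewrite mem_filter => /andP[/andP[u_gt0 _] uB].
  apply: IHn (Bd _ uB); last by rewrite u0 (le_trans (ltW ux)).
  apply: leq_trans cx.
  exact: count_lt uB ux.
have [|m Hm] := Bpl u x u0 ux x1.
  move=> w wB; apply/negP => /andP[uw wx].
  suff : w <= u by rewrite leNgt uw.
  have: w \in C by rewrite mem_filter wB wx (le_lt_trans u0).
  rewrite /u; elim: C {u u0 uC ux du uw} => // c C IHC.
  rewrite in_cons big_cons le_max => /orP[/eqP ->|/IHC ->].
    by rewrite lexx.
  by rewrite orbT.
rewrite Hm ?(ltW ux) ?lexx //; apply: dyadicD => //.
apply: dyadicM; first exact: dyadicX.
apply: dyadicD => //; apply: dyadicN.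
case: uC => [->|]; first exact: dyadic0.
by rewrite mem_filter => /andP[_ /Bd].
Qed.

Definition tone : thompson R.
Proof.
apply: (@Thompson R id id) => //; try by move=> x; exact: cvg_id.
exists [::] => // u v _ _ _ _; exists 0 => x _.
by rewrite expr0z mul1r addrC subrK.
Defined.

Lemma tmapV_lt g : {homo tmapV g : x y / x < y}.
Proof. by move=> x y xy; rewrite -(tmap_mono g) !tmapVK. Qed.

Lemma tmapV_out g (x : R) : ~~ (0 < x < 1) -> tmapV g x = x.
Proof. by move=> hx; rewrite -{1}(tmap_out g hx) tmapK. Qed.

Lemma tmapV_mono g : {mono tmapV g : x y / x < y}.
Proof. by apply: leW_mono; apply: le_mono; exact: tmapV_lt. Qed.

Lemma tmap_itv g (x : R) : 0 <= x <= 1 -> 0 <= tmap g x <= 1.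
Proof.
move=> /andP[x0 x1]; rewrite -{1}(tmap0 g) -(tmap1 g).
by rewrite !(le_mono (@tmap_lt _ g)) x0.
Qed.

Lemma tmapV_itv g (x : R) : 0 <= x <= 1 -> 0 <= tmapV g x <= 1.
Proof.
move=> /andP[x0 x1].
have V0 : tmapV g 0 = 0 by rewrite tmapV_out // ltxx.
have V1 : tmapV g 1 = 1 by rewrite tmapV_out // ltxx andbF.
apply/andP; split.
  by rewrite -[leLHS]V0 (le_mono (@tmapV_lt g)).
by rewrite -[leRHS]V1 (le_mono (@tmapV_lt g)).
Qed.

(* Breakpoints outside [0, 1] are irrelevant. *)
Lemma dyadic_pl_in (f : R -> R) : dyadic_pl f ->
  exists2 B : seq R, (forall w, w \in B -> 0 <= w <= 1 /\ dyadic w) &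
    forall u v : R, 0 <= u -> u < v -> v <= 1 ->
      (forall w, w \in B -> ~~ (u < w < v)) ->
      exists m : int, forall x, u <= x <= v -> f x = f u + 2 ^ m * (x - u).
Proof.
move=> [B Bd Bpl]; exists [seq w <- B | 0 <= w <= 1].
  by move=> w; rewrite mem_filter => /andP[-> /Bd].
move=> u v u0 uv v1 uvB; apply: Bpl => // w wB.
apply/negP => /andP[uw wv].
have : w \in [seq w <- B | 0 <= w <= 1].
  by rewrite mem_filter wB (le_trans u0 (ltW uw)) (le_trans (ltW wv) v1).
by move=> /uvB; rewrite uw wv.
Qed.

Lemma tmapV_pl g : dyadic_pl (tmapV g).
Proof.
have [B Bd Bpl] := dyadic_pl_in (tmap_pl g).
exists (map (tmap g) B).
  by move=> _ /mapP[w wB ->]; have [w01 dw] := Bd _ wB; exact: tmap_dyadic.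
move=> u v u0 uv v1 uvB.
have /andP[u'0 _] : 0 <= tmapV g u <= 1.
  by apply: tmapV_itv; rewrite u0 (le_trans (ltW uv)).
have /andP[_ v'1] : 0 <= tmapV g v <= 1.
  by apply: tmapV_itv; rewrite v1 (le_trans u0 (ltW uv)).
have uv' := tmapV_lt g uv.
have [|m Hm] := Bpl _ _ u'0 uv' v'1.
  move=> w wB; have /uvB := map_f (tmap g) wB.
  by rewrite -{1}(tmapVK g u) -{1}(tmapVK g v) !tmap_mono.
exists (- m) => x uxv.
have := Hm (tmapV g x); rewrite !tmapVK !(le_mono (@tmapV_lt g)) => /(_ uxv) Ex.
rewrite [X in _ * (X - u)]Ex [u + _ - u]addrAC subrr add0r mulrA.
rewrite -expfzDr ?pnatr_eq0 //.
by rewrite addNr expr0z mul1r [RHS]addrC subrK.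
Qed.

Definition tinv g : thompson R :=
  Thompson (@tmapVK _ g) (@tmapK _ g) (@tmapV_continuous _ g)
    (@tmap_continuous _ g) (@tmapV_lt g) (@tmapV_out g) (@tmapV_pl g).

Lemma tmapM_pl g h : dyadic_pl (tmap g \o tmap h).
Proof.
have [B Bd Bpl] := dyadic_pl_in (tmap_pl g).
have [C Cd Cpl] := tmap_pl h.
exists (map (tmapV h) B ++ C).
  move=> w; rewrite mem_cat => /orP[/mapP[z zB ->]|/Cd //].
  by have [z01 dz] := Bd _ zB; exact: (@tmap_dyadic (tinv h)).
move=> u v u0 uv v1 uvBC.
have [|m Hm] := Cpl u v u0 uv v1.
  by move=> w wC; apply: uvBC; rewrite mem_cat wC orbT.
have /andP[u'0 _] : 0 <= tmap h u <= 1.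
  by apply: tmap_itv; rewrite u0 (le_trans (ltW uv)).
have /andP[_ v'1] : 0 <= tmap h v <= 1.
  by apply: tmap_itv; rewrite v1 (le_trans u0 (ltW uv)).
have [|n Hn] := Bpl _ _ u'0 (tmap_lt h uv) v'1.
  move=> w wB; have := uvBC (tmapV h w); rewrite mem_cat map_f // => /(_ isT).
  by rewrite -(tmap_mono h u) -(tmap_mono h _ v) tmapVK.
exists (n + m) => x uxv /=.
rewrite Hn ?(le_mono (@tmap_lt _ h)) // (Hm x uxv).
by rewrite addrAC subrr add0r mulrA -expfzDr ?pnatr_eq0.
Qed.

Definition tmul g h : thompson R.
Proof.
apply: (@Thompson R (tmap g \o tmap h) (tmapV h \o tmapV g)).
- by apply: can_comp; exact: tmapK.
- by apply: can_comp; exact: tmapVK.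
- by move=> x; apply: continuous_comp; exact: tmap_continuous.
- by move=> x; apply: continuous_comp; exact: tmapV_continuous.
- by move=> x y xy /=; do 2!apply: tmap_lt.
- by move=> x hx /=; rewrite !tmap_out.
- exact: tmapM_pl.
Defined.

Lemma tmulA : associative tmul.
Proof. by move=> g h k; apply: thompson_eq. Qed.

Lemma tmul1g : left_id tone tmul.
Proof. by move=> g; apply: thompson_eq. Qed.

Lemma tmulg1 : right_id tone tmul.
Proof. by move=> g; apply: thompson_eq. Qed.

Lemma tmulVg : left_inverse tone tinv tmul.
Proof. by move=> g; apply: thompson_eq => x /=; rewrite tmapK. Qed.

Lemma tmulgV : right_inverse tone tinv tmul.
Proof. by move=> g; apply: thompson_eq => x /=; rewrite tmapVK. Qed.

End ThompsonGroup.

HB.instance Definition _ (R : realType) := gen_eqMixin (thompson R).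
HB.instance Definition _ (R : realType) := gen_choiceMixin (thompson R).
HB.instance Definition _ (R : realType) := isGroup.Build (thompson R)
  (@tmulA R) (@tmul1g R) (@tmulg1 R) (@tmulVg R) (@tmulgV R).

Section Generators.
Variable R : realType.
Implicit Types x y : R.

Lemma lipschitz2_continuous (f : R -> R) :
  {homo f : x y / x < y} ->
  (forall x y, x < y -> f y - f x <= 2 * (y - x)) -> continuous f.
Proof.
move=> fhomo f2 x; apply/cvgrPdist_le => e e0.
near=> y.
have yx : `|x - y| <= e / 2.
  near: y; apply: cvgr_dist_le; [exact: cvg_id|by rewrite divr_gt0].
have [xy|xy|->] := ltgtP x y; last by rewrite subrr normr0 ltW.
- have := fhomo _ _ xy; have := f2 _ _ xy; move: yx.
  by rewrite distrC (distrC (f x)) !ger0_norm ?subr_ge0 ?(ltW (fhomo _ _ xy))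
    ?(ltW xy) //; lra.
- have := fhomo _ _ xy; have := f2 _ _ xy; move: yx.
  by rewrite !ger0_norm ?subr_ge0 ?(ltW (fhomo _ _ xy)) ?(ltW xy) //; lra.
Unshelve. all: by end_near.
Qed.

Definition a_map x : R :=
  if x < 0 then x else if x <= 1/4 then 2 * x
  else if x <= 3/4 then x / 2 + 3/8 else x.

Definition a_mapV x : R :=
  if x < 0 then x else if x <= 1/2 then x / 2
  else if x <= 3/4 then 2 * x - 3/4 else x.

Definition b_map x : R :=
  if x <= 1/2 then x else if x <= 3/4 then x / 2 + 1/4
  else if x <= 7/8 then x - 1/8 else if x <= 1 then 2 * x - 1 else x.

Definition b_mapV x : R :=
  if x <= 1/2 then x else if x <= 5/8 then 2 * x - 1/2
  else if x <= 3/4 then x + 1/8 else if x <= 1 then x / 2 + 1/2 else x.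

Lemma dyadic_frac (m k : nat) : dyadic (m%:R / 2 ^+ k : R).
Proof. by exists m%:Z, k. Qed.

Variant a_map_spec x : R -> Prop :=
| a_map_spec0 of x < 0 : a_map_spec x x
| a_map_spec1 of 0 <= x & x <= 1/4 : a_map_spec x (2 * x)
| a_map_spec2 of 1/4 < x & x <= 3/4 : a_map_spec x (x / 2 + 3/8)
| a_map_spec3 of 3/4 < x : a_map_spec x x.

Lemma a_mapP x : a_map_spec x (a_map x).
Proof.
rewrite /a_map.
case: (ltP x 0) => h0; first by constructor.
case: (leP x (1/4)) => h1; first by constructor.
case: (leP x (3/4)) => h2; first by constructor.
by constructor.
Qed.

Variant a_mapV_spec x : R -> Prop :=
| a_mapV_spec0 of x < 0 : a_mapV_spec x x
| a_mapV_spec1 of 0 <= x & x <= 1/2 : a_mapV_spec x (x / 2)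
| a_mapV_spec2 of 1/2 < x & x <= 3/4 : a_mapV_spec x (2 * x - 3/4)
| a_mapV_spec3 of 3/4 < x : a_mapV_spec x x.

Lemma a_mapVP x : a_mapV_spec x (a_mapV x).
Proof.
rewrite /a_mapV.
case: (ltP x 0) => h0; first by constructor.
case: (leP x (1/2)) => h1; first by constructor.
case: (leP x (3/4)) => h2; first by constructor.
by constructor.
Qed.

Variant b_map_spec x : R -> Prop :=
| b_map_spec0 of x <= 1/2 : b_map_spec x x
| b_map_spec1 of 1/2 < x & x <= 3/4 : b_map_spec x (x / 2 + 1/4)
| b_map_spec2 of 3/4 < x & x <= 7/8 : b_map_spec x (x - 1/8)
| b_map_spec3 of 7/8 < x & x <= 1 : b_map_spec x (2 * x - 1)
| b_map_spec4 of 1 < x : b_map_spec x x.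

Lemma b_mapP x : b_map_spec x (b_map x).
Proof.
rewrite /b_map.
case: (leP x (1/2)) => h1; first by constructor.
case: (leP x (3/4)) => h2; first by constructor.
case: (leP x (7/8)) => h3; first by constructor.
case: (leP x 1) => h4; first by constructor.
by constructor.
Qed.

Variant b_mapV_spec x : R -> Prop :=
| b_mapV_spec0 of x <= 1/2 : b_mapV_spec x x
| b_mapV_spec1 of 1/2 < x & x <= 5/8 : b_mapV_spec x (2 * x - 1/2)
| b_mapV_spec2 of 5/8 < x & x <= 3/4 : b_mapV_spec x (x + 1/8)
| b_mapV_spec3 of 3/4 < x & x <= 1 : b_mapV_spec x (x / 2 + 1/2)
| b_mapV_spec4 of 1 < x : b_mapV_spec x x.

Lemma b_mapVP x : b_mapV_spec x (b_mapV x).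
Proof.
rewrite /b_mapV.
case: (leP x (1/2)) => h1; first by constructor.
case: (leP x (5/8)) => h2; first by constructor.
case: (leP x (3/4)) => h3; first by constructor.
case: (leP x 1) => h4; first by constructor.
by constructor.
Qed.

Lemma a_mapK : cancel a_map a_mapV.
Proof. by move=> x; case: a_mapP => *; case: a_mapVP => *; lra. Qed.

Lemma a_mapVK : cancel a_mapV a_map.
Proof. by move=> x; case: a_mapVP => *; case: a_mapP => *; lra. Qed.

Lemma a_map_lt : {homo a_map : x y / x < y}.
Proof. by move=> x y xy; case: (a_mapP x) => *; case: (a_mapP y) => *; lra. Qed.

Lemma a_map_continuous : continuous a_map.
Proof.
apply: lipschitz2_continuous => [|x y xy]; first exact: a_map_lt.
by case: (a_mapP x) => *; case: (a_mapP y) => *; lra.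
Qed.

Lemma a_mapV_continuous : continuous a_mapV.
Proof.
apply: lipschitz2_continuous => x y xy.
  by case: (a_mapVP x) => *; case: (a_mapVP y) => *; lra.
by case: (a_mapVP x) => *; case: (a_mapVP y) => *; lra.
Qed.

Lemma a_map_out x : ~~ (0 < x < 1) -> a_map x = x.
Proof.
by rewrite negb_and -!leNgt => /orP[?|?]; case: a_mapP => *; lra.
Qed.

Lemma b_mapK : cancel b_map b_mapV.
Proof. by move=> x; case: b_mapP => *; case: b_mapVP => *; lra. Qed.

Lemma b_mapVK : cancel b_mapV b_map.
Proof. by move=> x; case: b_mapVP => *; case: b_mapP => *; lra. Qed.

Lemma b_map_lt : {homo b_map : x y / x < y}.
Proof. by move=> x y xy; case: (b_mapP x) => *; case: (b_mapP y) => *; lra. Qed.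

Lemma b_map_continuous : continuous b_map.
Proof.
apply: lipschitz2_continuous => [|x y xy]; first exact: b_map_lt.
by case: (b_mapP x) => *; case: (b_mapP y) => *; lra.
Qed.

Lemma b_mapV_continuous : continuous b_mapV.
Proof.
apply: lipschitz2_continuous => x y xy.
  by case: (b_mapVP x) => *; case: (b_mapVP y) => *; lra.
by case: (b_mapVP x) => *; case: (b_mapVP y) => *; lra.
Qed.

Lemma b_map_out x : ~~ (0 < x < 1) -> b_map x = x.
Proof.
by rewrite negb_and -!leNgt => /orP[?|?]; case: b_mapP => *; lra.
Qed.

Lemma not_between (u v w : R) : ~~ (u < w < v) -> v <= w \/ w <= u.
Proof. by rewrite negb_and -!leNgt => /orP[]; [right|left]. Qed.

Lemma a_map_piece0 x : 0 <= x <= 1/4 -> a_map x = 2 * x.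
Proof. by move=> /andP[? ?]; case: a_mapP => *; lra. Qed.

Lemma a_map_piece1 x : 1/4 <= x <= 3/4 -> a_map x = x / 2 + 3/8.
Proof. by move=> /andP[? ?]; case: a_mapP => *; lra. Qed.

Lemma a_map_piece2 x : 3/4 <= x -> a_map x = x.
Proof. by move=> ?; case: a_mapP => *; lra. Qed.

Lemma b_map_piece0 x : x <= 1/2 -> b_map x = x.
Proof. by move=> ?; case: b_mapP => *; lra. Qed.

Lemma b_map_piece1 x : 1/2 <= x <= 3/4 -> b_map x = x / 2 + 1/4.
Proof. by move=> /andP[? ?]; case: b_mapP => *; lra. Qed.

Lemma b_map_piece2 x : 3/4 <= x <= 7/8 -> b_map x = x - 1/8.
Proof. by move=> /andP[? ?]; case: b_mapP => *; lra. Qed.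

Lemma b_map_piece3 x : 7/8 <= x <= 1 -> b_map x = 2 * x - 1.
Proof. by move=> /andP[? ?]; case: b_mapP => *; lra. Qed.

Lemma a_map_pl : dyadic_pl a_map.
Proof.
exists [:: 1%:R / 2 ^+ 2; 3%:R / 2 ^+ 2].
  by move=> w; rewrite !inE => /orP[] /eqP ->; exact: dyadic_frac.
move=> u v u0 uv v1 uvB.
have h0 : v <= 1/4 \/ 1/4 <= u.
  have := uvB (1%:R / 2 ^+ 2); rewrite !inE eqxx ?orbT => /(_ isT).
  by move/not_between; rewrite -natrX.
have h1 : v <= 3/4 \/ 3/4 <= u.
  have := uvB (3%:R / 2 ^+ 2); rewrite !inE eqxx ?orbT => /(_ isT).
  by move/not_between; rewrite -natrX.
move=> {uvB}.
case: h0 => [hv|hu0].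
  exists 1 => x /andP[ux xv]; rewrite expr1z.
  rewrite !a_map_piece0; lra.
case: h1 => [hv|hu1].
  exists (-1) => x /andP[ux xv]; rewrite exprN1.
  rewrite !a_map_piece1; lra.
exists 0 => x /andP[ux xv]; rewrite expr0z.
rewrite !a_map_piece2; lra.
Qed.

Lemma b_map_pl : dyadic_pl b_map.
Proof.
exists [:: 1%:R / 2 ^+ 1; 3%:R / 2 ^+ 2; 7%:R / 2 ^+ 3].
  by move=> w; rewrite !inE => /or3P[] /eqP ->; exact: dyadic_frac.
move=> u v u0 uv v1 uvB.
have h0 : v <= 1/2 \/ 1/2 <= u.
  have := uvB (1%:R / 2 ^+ 1); rewrite !inE eqxx ?orbT => /(_ isT).
  by move/not_between; rewrite -natrX.
have h1 : v <= 3/4 \/ 3/4 <= u.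
  have := uvB (3%:R / 2 ^+ 2); rewrite !inE eqxx ?orbT => /(_ isT).
  by move/not_between; rewrite -natrX.
have h2 : v <= 7/8 \/ 7/8 <= u.
  have := uvB (7%:R / 2 ^+ 3); rewrite !inE eqxx ?orbT => /(_ isT).
  by move/not_between; rewrite -natrX.
move=> {uvB}.
case: h0 => [hv|hu0].
  exists 0 => x /andP[ux xv]; rewrite expr0z.
  rewrite !b_map_piece0; lra.
case: h1 => [hv|hu1].
  exists (-1) => x /andP[ux xv]; rewrite exprN1.
  rewrite !b_map_piece1; lra.
case: h2 => [hv|hu2].
  exists 0 => x /andP[ux xv]; rewrite expr0z.
  rewrite !b_map_piece2; lra.
exists 1 => x /andP[ux xv]; rewrite expr1z.
rewrite !b_map_piece3; lra.
Qed.

Definition gen_a : thompson R :=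
  Thompson a_mapK a_mapVK a_map_continuous a_mapV_continuous a_map_lt
    a_map_out a_map_pl.

Definition gen_b : thompson R :=
  Thompson b_mapK b_mapVK b_map_continuous b_mapV_continuous b_map_lt
    b_map_out b_map_pl.

End Generators.

(* X = Z[1/2] \cap (0, 1). *)
Record dyad01 (R : realType) := MkDyad01 {
  dyad01_val : R;
  dyad01_valP : `[< dyadic dyad01_val >] && (0 < dyad01_val < 1) }.

HB.instance Definition _ (R : realType) := [isSub for @dyad01_val R].
HB.instance Definition _ (R : realType) := [Choice of dyad01 R by <:].

Section Lamplighter.
Variable R : realType.
Implicit Types (g h : thompson R) (x : dyad01 R) (E : {fset dyad01 R}).

Lemma root_subproof : `[< dyadic (5/8 : R) >] && (0 < (5/8 : R) < 1).
Proof.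
apply/andP; split; last by apply/andP; split; lra.
apply/asboolP; rewrite (_ : 5/8 = 5%:R / 2 ^+ 3); first exact: dyadic_frac.
by rewrite -natrX.
Qed.

Definition root_pt : dyad01 R := MkDyad01 root_subproof.

Lemma act_subproof g x :
  `[< dyadic (tmap g (\val x)) >] && (0 < tmap g (\val x) < 1).
Proof.
case: x => x /= /andP[/asboolP dx /andP[x0 x1]].
have gx0 : 0 < tmap g x by rewrite -[ltLHS](tmap0 g) tmap_mono.
have gx1 : tmap g x < 1 by rewrite -[ltRHS](tmap1 g) tmap_mono.
rewrite gx0 gx1 !andbT; apply/asboolP.
by apply: tmap_dyadic; rewrite ?(ltW x0) ?(ltW x1).
Qed.

Definition act g x : dyad01 R := MkDyad01 (act_subproof g x).

Lemma act1 x : act 1%g x = x.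
Proof. exact/val_inj. Qed.

Lemma actM g h x : act (g * h)%g x = act g (act h x).
Proof. exact/val_inj. Qed.

Lemma actK g : cancel (act g) (act g^-1%g).
Proof. by move=> x; rewrite -actM mulVg act1. Qed.

Lemma actVK g : cancel (act g^-1%g) (act g).
Proof. by move=> x; rewrite -actM mulgV act1. Qed.

Definition fset_act g E : {fset dyad01 R} := [fset act g x | x in E]%fset.

Definition symd E1 E2 : {fset dyad01 R} := ((E1 `\` E2) `|` (E2 `\` E1))%fset.

Lemma in_symd E1 E2 x : (x \in symd E1 E2) = (x \in E1) (+) (x \in E2).
Proof. by rewrite !inE; case: (x \in E1); case: (x \in E2). Qed.

Lemma in_fset_act g E x : (x \in fset_act g E) = (act g^-1%g x \in E).
Proof.
apply/imfsetP/idP => [[y /= yE ->]|xE]; first by rewrite actK.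
by exists (act g^-1%g x); rewrite ?actVK.
Qed.

End Lamplighter.

(* The semidirect product P_f(X) ><| F; its group law is lmul below. *)
Record lamplighter (R : realType) := Lamplighter {
  lset : {fset dyad01 R};
  lmap : thompson R }.

HB.instance Definition _ (R : realType) := gen_eqMixin (lamplighter R).
HB.instance Definition _ (R : realType) := gen_choiceMixin (lamplighter R).

Section LamplighterGroup.
Variable R : realType.
Implicit Types s t u : lamplighter R.

Definition lone : lamplighter R := Lamplighter fset0 1%g.

Definition lmul s t : lamplighter R :=
  Lamplighter (symd (lset s) (fset_act (lmap s) (lset t))) (lmap s * lmap t)%g.

Definition linv s : lamplighter R :=
  Lamplighter (fset_act (lmap s)^-1%g (lset s)) (lmap s)^-1%g.

Lemma lamplighter_eq s t : lset s =i lset t -> lmap s = lmap t -> s = t.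
Proof. by case: s t => E g [E' g'] /= /fsetP -> ->. Qed.

Lemma lmulA : associative lmul.
Proof.
move=> s t u; apply: lamplighter_eq => [x|] /=; last exact: mulgA.
by rewrite !(in_symd, in_fset_act) invgM actM addbA.
Qed.

Lemma lmul1g : left_id lone lmul.
Proof.
move=> s; apply: lamplighter_eq => [x|] /=; last exact: mul1g.
by rewrite in_symd in_fset_act inE invg1 act1.
Qed.

Lemma lmulg1 : right_id lone lmul.
Proof.
move=> s; apply: lamplighter_eq => [x|] /=; last exact: mulg1.
by rewrite in_symd in_fset_act inE addbF.
Qed.

Lemma lmulVg : left_inverse lone linv lmul.
Proof.
move=> s; apply: lamplighter_eq => [x|] /=; last exact: mulVg.
by rewrite in_symd !in_fset_act inE addbb.
Qed.

Lemma lmulgV : right_inverse lone linv lmul.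
Proof.
move=> s; apply: lamplighter_eq => [x|] /=; last exact: mulgV.
by rewrite in_symd !in_fset_act inE actK addbb.
Qed.

End LamplighterGroup.

HB.instance Definition _ (R : realType) := isGroup.Build (lamplighter R)
  (@lmulA R) (@lmul1g R) (@lmulg1 R) (@lmulVg R) (@lmulgV R).

Section MinFunctions.
Variable R : realType.

Definition lact (s : lamplighter R) (E : {fset dyad01 R}) : {fset dyad01 R} :=
  symd (lset s) (fset_act (lmap s) E).

Lemma lact1 E : lact 1%g E = E.
Proof.
by apply/fsetP => x; rewrite in_symd in_fset_act inE invg1 act1.
Qed.

Lemma lactM s t E : lact (s * t)%g E = lact s (lact t E).
Proof.
by apply/fsetP => x; rewrite !(in_symd, in_fset_act) invgM actM addbA.
Qed.

Definition superharmonic (phi : dyad01 R -> R) : Prop :=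
  forall x, phi x >= 1/4 * (phi (act (gen_a R) x) + phi (act (gen_b R) x)
    + phi (act (gen_a R)^-1%g x) + phi (act (gen_b R)^-1%g x)).

(* For a nonempty E the default value of the iterated minimum is the value of
   phi at an element of E, so only elements of E contribute. *)
Definition min_function (phi : dyad01 R -> R) (E : {fset dyad01 R}) : R :=
  if enum_fset E is x :: s then \big[Num.min/phi x]_(y <- s) phi y
  else phi (root_pt R).

Definition markov_op (f : {fset dyad01 R} -> R) (E : {fset dyad01 R}) : R :=
  1/5 * (f (fset_act (gen_a R) E) + f (fset_act (gen_b R) E)
    + f (fset_act (gen_a R)^-1%g E) + f (fset_act (gen_b R)^-1%g E)
    + f (symd E [fset root_pt R]%fset)).

Definition strong_approximation (h : {fset dyad01 R} -> R) : Prop :=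
  exists E : nat -> {fset dyad01 R}, forall s : lamplighter R,
    ((fun n => h (lact s (E n)) / h (E n)) @ \oo --> (1 : R))%classic.

End MinFunctions.

(* Main.v *)
Require Import Defs.
From mathcomp Require Import all_boot all_order all_algebra finmap.
From mathcomp Require Import all_classical all_reals all_analysis.
From mathcomp Require Import ring lra zify.
Import Order.TTheory GRing.Theory Num.Theory.
Import numFieldNormedType.Exports.
Local Open Scope ring_scope.

(* For [y <= 1/2] the points [a^-n y = y / 2^n] form a ray of the Schreier graph
   on which [b] acts trivially, so a positive superharmonic function restricted
   to it is concave in [n]; hence it is nondecreasing, and its relative variation
   over a bounded distance at depth [n] is O(1/n). Every element of F is
   [x |-> 2^m x] near 0, so it moves deep points of a ray by a bounded distance.

   On the other hand [phi - inf phi] is superharmonic and nonnegative; by the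
   Harnack inequality it is arbitrarily small at the base of some ray, and on
   that ray it grows at most linearly. So for each [n] there is a ray whose point
   of depth [n] has a [phi_i]-value at most that of the first [n] points of X. Let
   [E_n] consist of one such point for each [i]. For fixed [s = (D, g)] and large
   [n], [s E_n] is the disjoint union of [D] and [g E_n], the points of [D] do not
   lower the minimum, and so [f_i (s E_n) / f_i (E_n)] tends to 1 for every [s].
   This passes to [P^m f_i (s E_n) / f_i (E_n)] and to sums over [i]. *)

(** * Nonnegative concave sequences: monotonicity and relative variation *)

Section ConcaveSequences.
Local Set Implicit Arguments.
Local Unset Strict Implicit.
Variables (R : realType) (u : nat -> R).
Hypothesis u_ge0 : forall j, 0 <= u j.
Hypothesis u_concave : forall j, u j + u j.+2 <= 2 * u j.+1.

(** By concavity a strict descent would persist with at least the same slope and make [u]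
    negative. *)
Lemma concave_seq_homo : {homo u : i j / (i <= j)%N >-> i <= j}.
Proof.
apply: homo_leq => // [x|j]; [exact: le_trans|].
rewrite leNgt; apply/negP => uj.
have dec i : u (j + i).+1 - u (j + i)%N <= u j.+1 - u j.
  elim: i => [|i IHi]; first by rewrite addn0.
  by rewrite addnS; have := u_concave (j + i); lra.
have lin i : u (j + i)%N <= u j + i%:R * (u j.+1 - u j).
  elim: i => [|i IHi]; first by rewrite addn0 mul0r addr0.
  by rewrite addnS -natr1; have := dec i; lra.
have d0 : 0 < u j - u j.+1 by lra.
pose N := Num.bound (u j / (u j - u j.+1)).
have : u j / (u j - u j.+1) < N%:R.
  by apply: archi_boundP; rewrite divr_ge0 // ltW.
rewrite ltr_pdivrMr //; have := lin N; have := u_ge0 (j + N); lra.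
Qed.

(** Since [u 0 >= 0], the ratio [u j / j] is nonincreasing; the product form also covers index 0. *)
Lemma concave_seq_slope i j : (i <= j)%N -> i%:R * u j <= j%:R * u i.
Proof.
have step l : l%:R * u l.+1 <= l.+1%:R * u l.
  elim: l => [|l IHl]; first by rewrite mul0r mul1r.
  have := ler_wpM2l (ler0n R l.+1) (u_concave l).
  by move: IHl; rewrite -!natr1; lra.
elim: j => [|j IHj]; first by rewrite leqn0 => /eqP ->.
rewrite leq_eqVlt => /orP[/eqP -> //|]; rewrite ltnS => ij.
have [j0|j0] := posnP j.
  by move: ij; rewrite j0 leqn0 => /eqP ->; rewrite mul0r mulr_ge0.
have j0R : 0 < j%:R :> R by rewrite ltr0n.
rewrite -(ler_pM2l j0R) mulrCA.
apply: le_trans (ler_wpM2l (ler0n R i) (step j)) _.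
by rewrite !(mulrCA _ j.+1%:R) ler_wpM2l // IHj.
Qed.

(** Monotonicity fixes the sign of the difference; the slope bound then gives
    [|u j - u n| <= |j - n| u n / n]. *)
Lemma concave_seq_dist n j M : (j <= n + M)%N -> (n <= j + M)%N ->
  n%:R * `|u j - u n| <= M%:R * u n.
Proof.
have MM a b : (a <= b + M)%N -> a%:R <= b%:R + M%:R :> R.
  by rewrite -natrD ler_nat.
have n0 : 0 <= n%:R :> R := ler0n R n.
move=> /MM jn /MM nj; have un := u_ge0 n.
have [ij|/ltnW ij] := leqP n j.
  rewrite ger0_norm ?subr_ge0 ?concave_seq_homo //.
  by have := concave_seq_slope ij; have := ler_wpM2r un jn; lra.
rewrite ler0_norm ?subr_le0 ?concave_seq_homo //.
by have := concave_seq_slope ij; have := ler_wpM2r un nj; lra.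
Qed.

End ConcaveSequences.

(** * Superharmonic functions along the rays at 0 and at 1 *)

Section Rays.
Local Set Implicit Arguments.
Local Unset Strict Implicit.
Variable R : realType.
Local Notation X := (dyad01 R).
Local Notation a := (gen_a R).
Local Notation b := (gen_b R).
Implicit Types x y : X.

Definition ray n y : X := iter n (act a^-1%g) y.

Lemma val_ray n y : \val y <= 1/2 -> \val (ray n y) = \val y / 2 ^+ n.
Proof.
move=> y2; have y0 : 0 < \val y by case: y {y2} => y /= /and3P[].
elim: n => [|n IHn]; first by rewrite expr0 divr1.
have -> : \val (ray n.+1 y) = a_mapV (\val (ray n y)) by [].
rewrite IHn exprSr invfM mulrA.
have : \val y / 2 ^+ n <= \val y.
  by rewrite ler_pdivrMr ?exprn_gt0 // ler_peMr ?(ltW y0) // exprn_ege1 //; lra.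
have : 0 < \val y / 2 ^+ n by rewrite divr_gt0 ?exprn_gt0.
by case: a_mapVP => //; lra.
Qed.

Variable psi : X -> R.
Hypothesis psi_ge0 : forall x, 0 <= psi x.
Hypothesis psi_super : superharmonic psi.

Lemma superharmonic_Harnack x :
  psi (act a^-1%g x) <= 4 * psi x /\ psi (act b x) <= 4 * psi x.
Proof.
have := psi_super x; have := psi_ge0 (act a x); have := psi_ge0 (act b x).
have := psi_ge0 (act a^-1%g x); have := psi_ge0 (act b^-1%g x); lra.
Qed.

Lemma ray_concave y j : \val y <= 1/2 ->
  psi (ray j y) + psi (ray j.+2 y) <= 2 * psi (ray j.+1 y).
Proof.
move=> y2; have := psi_super (ray j.+1 y).
rewrite [act a (ray j.+1 y)]actVK.
have x2 : \val (ray j.+1 y) <= 1/2.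
  rewrite val_ray // ler_pdivrMr ?exprn_gt0 // (le_trans y2) //.
  by rewrite ler_peMr ?exprn_ege1 //; lra.
have -> : act b (ray j.+1 y) = ray j.+1 y.
  by apply/val_inj; exact: (@b_map_piece0 R).
have -> : act b^-1%g (ray j.+1 y) = ray j.+1 y.
  apply/val_inj; change (b_mapV (\val (ray j.+1 y)) = \val (ray j.+1 y)).
  by case: b_mapVP; lra.
rewrite -/(ray j.+2 y); lra.
Qed.

(** Near 1 the generators exchange roles: [a] fixes the points [b^-i x], so [psi] is concave along
    them and nondecreasing towards 1. *)
Lemma act_b_le x : 7/8 <= \val x -> psi (act b x) <= psi x.
Proof.
(* Starting at [b x] makes the claim the first increment of [v]; [b x] may lie below 7/8, but
   concavity is tested only at the later points. *)
move=> x7; pose v i := psi (iter i (act b^-1%g) (act b x)).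
have iterx i : 7/8 <= \val (iter i (act b^-1%g) x).
  elim: i => [//|i]; rewrite iterS; set w := iter _ _ _ => wi.
  have w1 : \val w < 1 by case: (w) => z /= /and3P[].
  by change (7/8 <= b_mapV (\val w)); case: b_mapVP; lra.
have iterSb i : iter i.+1 (act b^-1%g) (act b x) = iter i (act b^-1%g) x.
  by rewrite iterSr actK.
suff : v 0%N <= v 1%N by rewrite /v iterSb.
apply: (concave_seq_homo (u := v)) => // [i|j]; first exact: psi_ge0.
have := iterx j; rewrite /v !iterSb [iter j.+1 _ x]iterS.
have -> : iter j (act b^-1%g) (act b x) = act b (iter j (act b^-1%g) x).
  by rewrite -(iterSb j) /= actVK.
set w := iter j _ x => w7; have := psi_super w.
have -> : act a w = w.
  by apply/val_inj; change (a_map (\val w) = \val w); case: a_mapP; lra.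
have -> : act a^-1%g w = w.
  by apply/val_inj; change (a_mapV (\val w) = \val w); case: a_mapVP; lra.
lra.
Qed.

(* At most three generators take a point of [(1/2, 7/8]] below [1/2]; the points
   above [7/8] lie on the rays at 1, along which [b] decreases [psi]. *)
Lemma ray_base x : exists2 y, \val y <= 1/2 & psi y <= 64 * psi x.
Proof.
(* Above 7/8 the map [b] doubles [1 - x], so [j] bounds the number of moves by [b] that bring [x]
   down to 7/8. *)
have [j] : exists j : nat, 1 / 8 <= 2 ^+ j * (1 - \val x).
  have x1 : 0 < 1 - \val x by case: x => x /= /and3P[]; lra.
  exists (Num.bound (1 / (1 - \val x))).
  have /upper_nthrootP := leqnn (Num.bound (1 / (1 - \val x))).
  by rewrite ltr_pdivrMr //; lra.
elim: j x => [|j IHj] x.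
  rewrite expr0 mul1r => x7.
  have [x2|x2] := leP (\val x) (1/2).
    by exists x => //; have := psi_ge0 x; lra.
  have [x3|x3] := leP (\val x) (3/4).
    exists (act a^-1%g (act b x)).
      change (a_mapV (b_map (\val x)) <= 1/2).
      by case: b_mapP => *; case: a_mapVP; lra.
    have := psi_ge0 x; have [_] := superharmonic_Harnack x.
    by have [+ _] := superharmonic_Harnack (act b x); lra.
  (* The worst case: three Harnack steps, whence [64 = 4 ^ 3]. *)
  exists (act a^-1%g (act b (act b x))).
    change (a_mapV (b_map (b_map (\val x))) <= 1/2).
    by case: (b_mapP (\val x)) => *; case: b_mapP => *; case: a_mapVP; lra.
  have := psi_ge0 x; have [_] := superharmonic_Harnack x.
  have [_] := superharmonic_Harnack (act b x).
  by have [+ _] := superharmonic_Harnack (act b (act b x)); lra.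
have [x7|x7] := leP (7/8) (\val x); last first.
  move=> _; have [|y] := IHj x; last by exists y.
  have : 1 <= 2 ^+ j :> R by rewrite exprn_ege1 //; lra.
  have x1 : 0 <= 1 - \val x by lra.
  by move/(ler_wpM2r x1); lra.
have Eb : \val (act b x) = 2 * \val x - 1.
  apply: (@b_map_piece3 R); rewrite x7.
  by case: (x) => z /= /and3P[_ _ /ltW].
rewrite exprSr => Hj; have [|y y2 Hy] := IHj (act b x); first by rewrite Eb; lra.
by exists y => //; have := act_b_le x7; lra.
Qed.

(** The slope bound is void at index 0, so growth is compared with depth 1, where the Harnack
    inequality gives [4 psi y]. *)
Lemma ray_growth n y : \val y <= 1/2 -> psi (ray n y) <= n.+1%:R * (4 * psi y).
Proof.
move=> y2; case: n => [|n]; first by rewrite mul1r; have := psi_ge0 y; rewrite /=; lra.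
have := @concave_seq_slope R (fun j => psi (ray j y)) (fun j => psi_ge0 _)
  (fun j => ray_concave j y2) 1%N n.+1 isT.
rewrite mul1r => /le_trans; apply.
apply: ler_pM => //; first by rewrite ler_nat.
by have [] := superharmonic_Harnack y.
Qed.

End Rays.

(** * Deep points of rays: low values, action of F, avoidance of finite sets *)

Section RayPoints.
Local Set Implicit Arguments.
Local Unset Strict Implicit.
Variable R : realType.
Local Notation X := (dyad01 R).
Implicit Types x y : X.

Lemma low_ray (phi : X -> R) : (forall x, 0 <= phi x) -> superharmonic phi ->
  forall n d, exists2 y, \val y <= 1/2 & phi (ray n y) <= phi d.
Proof.
move=> phi_ge0 phi_super n d.
pose c := inf (range phi).
have lb : has_lbound (range phi) by exists 0 => _ [x _ <-].
have c_le x : c <= phi x by apply: ge_inf => //; exists x.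
pose psi x := phi x - c.
have psi_ge0 x : 0 <= psi x by rewrite subr_ge0.
have psi_super : superharmonic psi by move=> x; have := phi_super x; rewrite /psi; lra.
have K0 : 0 < n.+1%:R * 256 :> R by rewrite mulr_gt0 // ltr0n.
(* The factor [256 = 64 * 4] absorbs the constants of [ray_base] and [ray_growth]. If [phi] attains
   its infimum at [d], then [d] itself serves. *)
have [x Hx] : exists x, n.+1%:R * 256 * psi x <= psi d.
  have := psi_ge0 d; rewrite le_eqVlt => /orP[/eqP d0|d0].
    by exists d; rewrite -d0 mulr0.
  have e0 : 0 < psi d / (n.+1%:R * 256) by rewrite divr_gt0.
  have [|_ [x _ <-] xc] := inf_adherent e0 (_ : has_inf (range phi)).
    by split=> //; exists (phi d), d.
  exists x; have : psi x <= psi d / (n.+1%:R * 256) by rewrite lerBlDl ltW.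
  by rewrite ler_pdivlMr // mulrC.
have [y y2 Hy] := ray_base psi_ge0 psi_super x.
exists y => //; suff : psi (ray n y) <= psi d by rewrite /psi; lra.
apply: le_trans (ray_growth psi_ge0 psi_super n y2) _.
apply: le_trans Hx; rewrite -mulrA ler_pM2l ?ltr0n //; lra.
Qed.

Lemma low_ray_seq (phi : X -> R) : (forall x, 0 <= phi x) -> superharmonic phi ->
  forall n (s : seq X), exists2 y, \val y <= 1/2 &
    {in s, forall d, phi (ray n y) <= phi d}.
Proof.
move=> phi_ge0 phi_super n s.
have [d Hd] : exists d, {in s, forall d', phi d <= phi d'}.
  elim: s => [|x s [d Hd]]; first by exists (root_pt R).
  have [xd|/ltW dx] := leP (phi x) (phi d).
    exists x => d'; rewrite inE => /orP[/eqP -> //|/Hd]; exact: le_trans.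
  by exists d => d'; rewrite inE => /orP[/eqP -> //|/Hd].
have [y y2 Hy] := low_ray phi_ge0 phi_super n d.
by exists y => // d' /Hd; exact: le_trans.
Qed.

(** The point [x] makes [E] nonempty, which excludes the default value at the root. *)
Lemma min_functionP (phi : X -> R) (E : {fset X}) x : x \in E ->
  (exists2 e, e \in E & min_function phi E = phi e) /\
  {in E, forall e, min_function phi E <= phi e}.
Proof.
have EE e : (e \in E) = (e \in enum_fset E) by [].
rewrite EE; rewrite /min_function; case: (enum_fset E) EE => // z s EE _.
split.
  rewrite big_seq; elim/big_ind: _ => [|u v [e eE ->] [e' eE' ->]|e es].
  - by exists z => //; rewrite EE mem_head.
  - by case: leP => _; [exists e|exists e'].
  - by exists e => //; rewrite EE inE es orbT.
move=> e; rewrite EE inE => /orP[/eqP ->|es].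
  elim: s {EE} => [|w s IHs]; first by rewrite big_nil.
  by rewrite big_cons ge_min IHs orbT.
elim: s {EE} es => // w s IHs; rewrite inE big_cons ge_min.
by move=> /orP[/eqP ->|/IHs ->]; rewrite ?lexx ?orbT.
Qed.

Lemma tmap_germ (g : thompson R) : exists2 e : R, 0 < e &
  exists m : int, forall t, 0 <= t <= e -> tmap g t = 2 ^ m * t.
Proof.
have [B _ Bpl] := tmap_pl g.
(* The smallest positive breakpoint, capped at 1: no breakpoint lies in [(0, e)]. *)
pose e := \big[Num.min/1]_(w <- B | 0 < w) w.
have e0 : 0 < e.
  by rewrite /e; elim/big_ind: _ => // u v u0 v0; rewrite lt_min u0.
have e1 : e <= 1.
  rewrite /e; elim: (B) => [|w s IHs]; first by rewrite big_nil.
  by rewrite big_cons; case: ifP => // _; rewrite ge_min IHs orbT.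
exists e => //; have [|m Hm] := Bpl 0 e (lexx 0) e0 e1; last first.
  by exists m => x /Hm; rewrite tmap0 add0r subr0.
move=> w wB; apply/negP => /andP[w0]; rewrite ltNge => /negP; apply.
rewrite /e; elim: (B) wB => // z s IHs; rewrite inE big_cons.
case/orP => [/eqP <-|/IHs ws]; first by rewrite w0 ge_min lexx.
by case: ifP => // _; rewrite ge_min ws orbT.
Qed.

Lemma act_ray (g : thompson R) : exists M : nat, forall n y,
  \val y <= 1/2 -> (M <= n)%N ->
  exists j, [/\ (j <= n + M)%N, (n <= j + M)%N & act g (ray n y) = ray j y].
Proof.
have [e e0 [m Hm]] := tmap_germ g.
(* The first summand puts [ray n y] inside [[0, e]], where [g] is linear; the second bounds the
   shift. Neither depends on [y]. *)
exists (Num.bound e^-1 + `|m|)%N => n y y2 Mn.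
have y0 : 0 < \val y by case: (y) => z /= /and3P[].
have gx : \val (act g (ray n y)) = 2 ^ m * (\val y / 2 ^+ n).
  change (tmap g (\val (ray n y)) = 2 ^ m * (\val y / 2 ^+ n)).
  rewrite val_ray // Hm // divr_ge0 ?exprn_ge0 ?(ltW y0) //.
  rewrite ler_pdivrMr ?exprn_gt0 //.
  have /upper_nthrootP : (Num.bound e^-1 <= n)%N by lia.
  by rewrite -[e^-1]mul1r ltr_pdivrMr //; lra.
case: m Hm Mn gx => p _ Mn gx.
  exists (n - p)%N; split; try lia.
  apply/val_inj; rewrite gx val_ray //.
  have -> : n = (n - p + p)%N by lia.
  rewrite addnK exprD -exprnP.
  by field; rewrite !expf_neq0 ?pnatr_eq0.
(* Here [m] is [Negz p], that is [- p.+1], and [g] moves deeper. *)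
exists (n + p.+1)%N; split; try lia.
apply/val_inj; rewrite gx val_ray // exprD NegzE -exprnN.
by field; rewrite !expf_neq0 ?pnatr_eq0.
Qed.

(** Decodes a pair (numerator, exponent); codes that give no point of X go to the root. *)
Definition dyad01_nth (N : nat) : X :=
  odflt (root_pt R)
    (obind (fun q : int * nat => insub (q.1%:~R / 2 ^+ q.2 : R)) (choice.unpickle N)).

Lemma dyad01_nth_surj x : exists N, dyad01_nth N = x.
Proof.
have [m [k Ex]] : dyadic (\val x) by case: (x) => z /= /andP[/asboolP].
by exists (choice.pickle (m, k)); rewrite /dyad01_nth choice.pickleK /= -Ex valK.
Qed.

Lemma dyad01_exhaust (D : {fset X}) : exists N, forall n, (N <= n)%N ->
  {subset D <= [seq dyad01_nth j | j <- iota 0 n]}.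
Proof.
suff [N HN] : exists N, forall n, (N <= n)%N ->
    {subset enum_fset D <= [seq dyad01_nth j | j <- iota 0 n]}.
  by exists N.
elim: (enum_fset D) => [|x s [N HN]]; first by exists 0%N.
have [j <-] := dyad01_nth_surj x; exists (maxn N j.+1) => n.
rewrite geq_max => /andP[/HN Hn jn] z; rewrite inE => /orP[/eqP ->|/Hn //].
by apply: map_f; rewrite mem_iota.
Qed.

(** Points of depth [j] are below [2^-j] for every [y], hence eventually below all elements of
    [D]. *)
Lemma ray_notin (D : {fset X}) : exists N, forall j y,
  \val y <= 1/2 -> (N <= j)%N -> ray j y \notin D.
Proof.
suff [N HN] : exists N, forall j y,
    \val y <= 1/2 -> (N <= j)%N -> ray j y \notin enum_fset D.
  by exists N.
elim: (enum_fset D) => [|x s [N HN]]; first by exists 0%N.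
exists (maxn N (Num.bound (\val x)^-1)) => j y y2.
rewrite geq_max => /andP[/(HN _ _ y2) Hj /upper_nthrootP].
have x0 : 0 < \val x by case: (x) => z /= /and3P[].
rewrite -[_^-1]mul1r ltr_pdivrMr // => jx; rewrite inE negb_or Hj andbT.
apply/eqP => /(congr1 val); rewrite val_ray // => Ex.
move: jx; rewrite -Ex mulrCA divff ?expf_neq0 ?pnatr_eq0 //; lra.
Qed.

End RayPoints.

(** * The approximating sets and the ratios of iterated min-functions *)

Section Approximation.
Local Set Implicit Arguments.
Local Unset Strict Implicit.
Variable R : realType.
Local Notation X := (dyad01 R).

Lemma cvg1_rate (u : nat -> R) (N : nat) (C : R) :
  (forall n, (N <= n)%N -> n%:R * `|u n - 1| <= C) -> (u @ \oo --> (1 : R))%classic.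
Proof.
move=> Hu; apply/cvgrPdist_le => e e0.
near=> n.
have Nn : (N <= n)%N by near: n; exact: nbhs_infty_ge.
have n1 : (Num.bound (C / e) < n)%N by near: n; exact: nbhs_infty_gt.
have n0 : 0 < n%:R :> R by rewrite ltr0n; lia.
have : C / e < n%:R.
  by apply: lt_trans (unstable.ltr_bound _) _; rewrite ltr_nat.
rewrite ltr_pdivrMr // => Cn; rewrite distrC -(ler_pM2l n0).
by apply: le_trans (Hu _ Nn) _; exact: ltW.
Unshelve. all: by end_near.
Qed.

(** Each of the five terms evaluates [F] at a lamplighter translate, and the hypothesis covers all
    [s]. Keeping [c] independent of [F] lets the lemma be iterated. *)
Lemma cvg_markov_op (F : {fset X} -> R) (E : nat -> {fset X}) (c : nat -> R) :
  (forall s, ((fun n => F (lact s (E n)) / c n) @ \oo --> (1 : R))%classic) ->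
  forall s, ((fun n => markov_op F (lact s (E n)) / c n) @ \oo --> (1 : R))%classic.
Proof.
move=> HF s.
pose v t n := F (lact (t * s)%g (E n)) / c n.
pose L g := Lamplighter fset0 g : lamplighter R.
have actE g D : fset_act g D = lact (L g) D.
  by apply/fsetP => x; rewrite in_symd inE.
have symE D :
    symd D [fset root_pt R]%fset = lact (Lamplighter [fset root_pt R]%fset 1%g) D.
  by apply/fsetP => x; rewrite !in_symd in_fset_act invg1 act1 addbC.
have -> : (fun n => markov_op F (lact s (E n)) / c n) = (fun n => 1/5 *
    (v (L (gen_a R)) n + v (L (gen_b R)) n + v (L (gen_a R)^-1%g) n
      + v (L (gen_b R)^-1%g) n + v (Lamplighter [fset root_pt R]%fset 1%g) n)).
  apply/funext => n; rewrite /markov_op /v !lactM -!actE -symE; ring.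
rewrite [X in (_ --> X)%classic](_ : _ = 1/5 * (1 + 1 + 1 + 1 + 1)); last by field.
apply: cvgM; first exact: cvg_cst.
by do !apply: cvgD; exact: HF.
Qed.

Variables (k : nat) (phi : 'I_k -> X -> R).
Hypothesis phi_gt0 : forall i x, 0 < phi i x.
Hypothesis phi_super : forall i, superharmonic (phi i).
Variable y : nat -> 'I_k -> X.
Hypothesis y_le : forall n i, \val (y n i) <= 1/2.
Hypothesis y_low : forall n i,
  {in [seq dyad01_nth R j | j <- iota 0 n],
    forall d, phi i (ray n (y n i)) <= phi i d}.

Definition ray_set n : {fset X} := [fset ray n (y n i) | i : 'I_k]%fset.

Lemma mem_ray_set n i : ray n (y n i) \in ray_set n.
Proof. exact/imfsetP/(ex_intro2 _ _ i). Qed.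

Lemma min_function_gt0 i n : 0 < min_function (phi i) (ray_set n).
Proof.
by have [[e _ ->] _] := min_functionP (phi i) (mem_ray_set n i).
Qed.

Lemma min_function_lact i s : exists N M : nat, forall n, (N <= n)%N ->
  n%:R * `|min_function (phi i) (lact s (ray_set n))
      - min_function (phi i) (ray_set n)|
    <= M%:R * min_function (phi i) (ray_set n).
Proof.
have [M HM] := act_ray (lmap s).
have [N1 HN1] := dyad01_exhaust (lset s).
have [N2 HN2] := ray_notin (lset s).
(* [N1] puts [D = lset s] among the first [n] points, [N2] keeps the moved points off [D], and [M]
   allows for the displacement by [g = lmap s]. *)
exists (N1 + N2 + M)%N, M => n Nn.
have Mn : M%:R <= n%:R :> R by rewrite ler_nat; lia.
pose x j := ray n (y n j).
have gx j : act (lmap s) (x j) \notin lset s /\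
    n%:R * `|phi i (act (lmap s) (x j)) - phi i (x j)| <= M%:R * phi i (x j).
  have [|l [ln nl ->]] := HM n (y n j) (y_le n j); first by lia.
  split; first by apply: HN2 => //; lia.
  apply: (concave_seq_dist (u := fun l => phi i (ray l (y n j)))) => // [p|p].
    exact: ltW.
  by apply: ray_concave => // z; exact: ltW.
have mem_gx j : act (lmap s) (x j) \in lact s (ray_set n).
  by rewrite in_symd (negbTE (gx j).1) in_fset_act actK mem_ray_set.
have [[_ /imfsetP[j0 /= _ ->] Ef] f_le] := min_functionP
  (phi i) (mem_ray_set n i).
have [[e es Ef1] f1_le] := min_functionP (phi i) (mem_gx i).
have f0 := min_function_gt0 i n.
set f := min_function _ _ in Ef f_le f0 *; set f1 := min_function _ _ in Ef1 f1_le *.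
rewrite -[ray _ _]/(x j0) in Ef.
have gx_itv j : (n%:R - M%:R) * phi i (x j) <= n%:R * phi i (act (lmap s) (x j))
    /\ n%:R * phi i (act (lmap s) (x j)) <= (n%:R + M%:R) * phi i (x j).
  have [_] := gx j; rewrite -[X in X * _]normr_nat -normrM ler_norml.
  by move=> /andP[]; split; lra.
rewrite -[X in X * _]normr_nat -normrM ler_norml; apply/andP; split; last first.
  (* Upper bound: [x j0] attains [f], and its image lies in the translate. *)
  have [_] := gx_itv j0; have := ler_wpM2l (ler0n R n) (f1_le _ (mem_gx j0)).
  rewrite -Ef; lra.
suff : (n%:R - M%:R) * f <= n%:R * f1 by lra.
have nM : 0 <= n%:R - M%:R :> R by lra.
(* Lower bound: a minimiser [e] in [D] is among the first [n] points, so its value is at least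
   [phi i (x i) >= f]; any other is some [g (x j)]. *)
rewrite Ef1; have [eD|eD] := boolP (e \in lset s).
  have fe : f <= phi i e.
    apply: le_trans (f_le _ (mem_ray_set n i)) _; apply: y_low.
    by apply: HN1 eD; lia.
  have := ler_wpM2l (ler0n R n) fe; have := mulr_ge0 (ler0n R M) (ltW f0); lra.
have [j ->] : exists j, e = act (lmap s) (x j).
  move: es; rewrite in_symd (negbTE eD) in_fset_act => /imfsetP[j /= _ Ej].
  by exists j; rewrite /x -Ej actVK.
have [+ _] := gx_itv j; apply: le_trans.
by apply: ler_wpM2l nM _ _ _; apply: f_le; exact: mem_ray_set.
Qed.

Lemma cvg_iter_markov_op i m s :
  ((fun n => iter m (@markov_op R) (min_function (phi i)) (lact s (ray_set n))
    / min_function (phi i) (ray_set n)) @ \oo --> (1 : R))%classic.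
Proof.
elim: m s => [|m IHm]; last exact: cvg_markov_op.
move=> s /=; have [N [M HNM]] := min_function_lact i s.
apply: (@cvg1_rate _ N M%:R) => n Nn.
have f0 := min_function_gt0 i n.
rewrite -(ler_pM2r f0) -mulrA.
rewrite -[X in _ * (_ * X)]gtr0_norm // -normrM mulrBl mul1r mulfVK ?gt_eqF //.
exact: HNM.
Qed.

End Approximation.

(** * Passage to the sum over [i] *)

Section Sums.
Local Set Implicit Arguments.
Local Unset Strict Implicit.
Variable R : realType.

(** The quotient of the sums is the mean of the ratios with positive weights [c i n]; finitely many
    [i] share one threshold for [e]. *)
Lemma cvg_weighted (k : nat) (F c : 'I_k -> nat -> R) : (0 < k)%N ->
  (forall i n, 0 < c i n) ->
  (forall i, ((fun n => F i n / c i n) @ \oo --> (1 : R))%classic) ->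
  ((fun n => (\sum_i F i n) / \sum_i c i n) @ \oo --> (1 : R))%classic.
Proof.
move=> k0 c0 HF; apply/cvgrPdist_le => e e0.
have : (\forall n \near \oo, forall i, `|1 - F i n / c i n| <= e)%classic.
  apply: filter_forall => i.
  by have /cvgrPdist_le := HF i; apply.
apply: filterS => n Hn.
have dist_ratio x d : 0 < d -> `|1 - x / d| * d = `|d - x| :> R.
  move=> d0; rewrite -[X in _ * X]gtr0_norm // -normrM mulrBl mul1r.
  by rewrite divfK // gt_eqF.
have S0 : 0 < \sum_i c i n.
  rewrite (bigD1 (Ordinal k0)) //= ltr_pwDl //; apply: sumr_ge0 => i _; exact: ltW.
rewrite -(ler_pM2r S0) dist_ratio // -sumrB mulr_sumr.
apply: le_trans (ler_norm_sum _ _ _) _; apply: ler_sum => i _.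
by rewrite -dist_ratio // ler_pM2r.
Qed.

End Sums.

Theorem theorem14 (R : realType) (k : nat) (hk : (1 <= k)%N)
    (phi : 'I_k -> dyad01 R -> R)
    (phi_gt0 : forall i x, 0 < phi i x)
    (phi_super : forall i, superharmonic (phi i))
    (phi_root : forall i q, phi i q <= phi i (root_pt R))
    (n : 'I_k -> nat) :
  strong_approximation
    (fun E => \sum_(i < k) iter (n i) (@markov_op R) (min_function (phi i)) E).
Proof.
have low m i : exists z : dyad01 R, \val z <= 1/2 /\
    {in [seq dyad01_nth R j | j <- iota 0 m],
      forall d, phi i (ray m z) <= phi i d}.
  have [z z2 Hz] := low_ray_seq (fun x => ltW (phi_gt0 i x)) (phi_super i) m
    [seq dyad01_nth R j | j <- iota 0 m].
  by exists z.
have [z Hz] := choice (fun p : nat * 'I_k => low p.1 p.2).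
pose y m i := z (m, i).
exists (ray_set y) => s.
pose c m := \sum_i min_function (phi i) (ray_set y m).
have H t : ((fun m => (\sum_(i < k) iter (n i) (@markov_op R) (min_function (phi i))
    (lact t (ray_set y m))) / c m) @ \oo --> (1 : R))%classic.
  apply: cvg_weighted => // [i m|i].
    exact: min_function_gt0.
  by apply: cvg_iter_markov_op => // m j; have [] := Hz (m, j).
have c0 m : 0 < c m.
  rewrite /c (bigD1 (Ordinal hk)) //= ltr_pwDl ?min_function_gt0 //.
  by apply: sumr_ge0 => i _; rewrite ltW // min_function_gt0.
(* Both [h (s E_m)] and [h (E_m)] are compared with the same [c m], the latter through [s = 1]. *)
have -> : (fun m => (\sum_(i < k) iter (n i) (@markov_op R) (min_function (phi i))
      (lact s (ray_set y m))) / \sum_(i < k) iter (n i) (@markov_op R)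
      (min_function (phi i)) (ray_set y m)) =
    (fun m => (\sum_(i < k) iter (n i) (@markov_op R) (min_function (phi i))
      (lact s (ray_set y m))) / c m / ((\sum_(i < k) iter (n i) (@markov_op R)
      (min_function (phi i)) (lact 1%g (ray_set y m))) / c m)).
  by apply/funext => m; rewrite lact1 invfM invrK mulrA mulrAC divfK // gt_eqF.
rewrite -[X in (_ --> X)%classic](divr1 1).
by apply: cvgM => //; apply: cvgV => //; exact: oner_neq0.
Qed.
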